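(* Let $i\neq j$ be two rectangular objects with parameters $\mathrm{LB}_{ks},\mathrm{UB}_{ks},\mathrm{P}_{kls}$ ($(k,l,s)\in\mathscr{F}_{ij}$) as described in the context. If $\mathrm{P}_{kls}<\mathrm{UB}_{ls}-\mathrm{LB}_{ks}$ for each $(k,l,s)\in\mathscr{F}_{ij}$, then the Standard Unary formulation (SU) is pairwise-ideal; that is, every extreme point $(\mathbf{c},\boldsymbol\delta)\in\mathbb{R}^4\times\mathbb{R}^4$ of the continuous relaxation of (SU) for the pair $(i,j)$ satisfies $\boldsymbol\delta\in\{0,1\}^4$.
   Context: Parameters. The region has dimensions $W_x\times W_y$. Each object $k\in\{i,j\}$ has dimensions $w_{ks}>0$ and clearances $\sigma^-_{ks},\sigma^+_{ks}\ge 0$ for $s\in\{x,y\}$. Put $\mathscr{F}_{ij}=\{(i,j,x),(j,i,x),(i,j,y),(j,i,y)\}$, $\mathrm{LB}_{ks}=\tfrac12 w_{ks}+\sigma^-_{ks}$ and $\mathrm{UB}_{ks}=W_s-\tfrac12 w_{ks}-\sigma^+_{ks}$. The precedence margins $\mathrm{P}_{kls}$, $(k,l,s)\in\mathscr{F}_{ij}$, are reals with $\mathrm{P}_{kls}\ge\tfrac12 w_{ks}+\tfrac12 w_{ls}+\max\{\sigma^+_{ks},\sigma^-_{ls}\}$ (equality in the basic model; larger margins are allowed). Formulation (SU) for the pair $(i,j)$. Continuous variables $c_{ix},c_{jx},c_{iy},c_{jy}$ and binary variables $\delta_{ijx},\delta_{jix},\delta_{ijy},\delta_{jiy}$, with constraints,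 for all $(k,l,s)\in\mathscr{F}_{ij}$: $$c_{ls}\ge \mathrm{LB}_{ls}+(\mathrm{LB}_{ks}+\mathrm{P}_{kls}-\mathrm{LB}_{ls})\delta_{kls},$$ $$c_{ks}\le \mathrm{UB}_{ks}+(\mathrm{UB}_{ls}-\mathrm{P}_{kls}-\mathrm{UB}_{ks})\delta_{kls},$$ $$c_{ks}-c_{ls}\le \mathrm{UB}_{ks}-\mathrm{LB}_{ls}+(\mathrm{LB}_{ls}-\mathrm{P}_{kls}-\mathrm{UB}_{ks})\delta_{kls},$$ $$\delta_{kls}\in\{0,1\},$$ together with $\delta_{ijx}+\delta_{jix}+\delta_{ijy}+\delta_{jiy}=1$. The continuous relaxation replaces $\delta_{kls}\in\{0,1\}$ by $0\le\delta_{kls}\le1$. A mixed-integer program is ideal if every extreme point of its continuous relaxation takes integer values in all integer variables; a packing formulation is pairwise-ideal if it is ideal when restricted to two objects. *)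

(* Defs.v *)
From HB Require Import structures.
From mathcomp Require Import all_boot all_order all_algebra.
From mathcomp Require Import mathcomp_extra boolp classical_sets reals.

Set Implicit Arguments.
Unset Strict Implicit.
Unset Printing Implicit Defensive.
Import Order.TTheory GRing.Theory Num.Theory.
Local Open Scope classical_set_scope.
Local Open Scope ring_scope.

Definition extreme_point (R : realType) (V : lmodType R) (A : set V) (v : V) :
    Prop :=
  A v /\ forall (a b : V) (t : R), A a -> A b -> 0 < t < 1 ->
    v = t *: a + (1 - t) *: b -> a = v /\ b = v.

(* A mixed-integer program all of whose integer variables are binary;
   [constraints] does not include the constraints on the binary variables. *)
Record mip (R : realType) (V : lmodType R) := Mip {
  constraints : set V;
  nbin : nat;
  bin_var : 'I_nbin -> V -> R }.

Definition feasible (R : realType) (V : lmodType R) (M : mip V) : set V :=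
  [set v | constraints M v /\
           forall m : 'I_(nbin M), bin_var m v = 0 \/ bin_var m v = 1].

Definition relaxation (R : realType) (V : lmodType R) (M : mip V) : set V :=
  [set v | constraints M v /\ forall m : 'I_(nbin M), 0 <= bin_var m v <= 1].

Definition ideal (R : realType) (V : lmodType R) (M : mip V) : Prop :=
  forall v : V, extreme_point (relaxation M) v ->
    forall m : 'I_(nbin M), bin_var m v \is a Num.int.

Inductive axis := X | Y.

Definition bool_of_axis (s : axis) : bool := if s is X then true else false.
Definition axis_of_bool (b : bool) : axis := if b then X else Y.
Lemma bool_of_axisK : cancel bool_of_axis axis_of_bool.
Proof. by case. Qed.
HB.instance Definition _ := Equality.copy axis (can_type bool_of_axisK).

Section Packing.
Variables (R : realType) (T : eqType).
Implicit Types (i j k l : T) (s : axis).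

Definition LB (w sm : T -> axis -> R) k s : R := w k s / 2 + sm k s.

Definition UB (W : axis -> R) (w sp : T -> axis -> R) k s : R :=
  W s - w k s / 2 - sp k s.

Definition F i j : seq (T * T * axis) :=
  [:: (i, j, X); (j, i, X); (i, j, Y); (j, i, Y)].

(* The coordinates of the first factor are c_ix, c_jx, c_iy, c_jy, in this
   order; those of the second factor are indexed by F i j, in its order. *)
Definition SU_space : lmodType R := ('rV[R]_4 * 'rV[R]_4)%type.

(* Meaningful only for i <> j and k among i, j. *)
Definition cvar i j (v : SU_space) k s : R :=
  v.1 ord0 (inord (index (k, s) [:: (i, X); (j, X); (i, Y); (j, Y)])).

(* Meaningful only for i <> j and (k, l, s) in F i j. *)
Definition dvar i j (v : SU_space) k l s : R :=
  v.2 ord0 (inord (index (k, l, s) (F i j))).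

Definition SU_constraints (LB UB : T -> axis -> R) (P : T -> T -> axis -> R)
    i j : set SU_space :=
  [set v |
    let c := cvar i j v in
    let d := dvar i j v in
    (forall k l s, (k, l, s) \in F i j ->
      [/\ c l s >= LB l s + (LB k s + P k l s - LB l s) * d k l s,
          c k s <= UB k s + (UB l s - P k l s - UB k s) * d k l s &
          c k s - c l s <=
            UB k s - LB l s + (LB l s - P k l s - UB k s) * d k l s]) /\
    d i j X + d j i X + d i j Y + d j i Y = 1].

Definition SU (LB UB : T -> axis -> R) (P : T -> T -> axis -> R) i j :
    mip SU_space :=
  {| constraints := SU_constraints LB UB P i j;
     nbin := 4;
     bin_var := fun m v => v.2 ord0 m |}.

End Packing.

(* Main.v *)
(* The relaxation is the convex hull of its points with a unit vector delta.
   On each axis s the point (c_is, c_js) must be split into a point of the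
   triangle "i precedes j" scaled by delta_ijs, a point of the triangle
   "j precedes i" scaled by delta_jis, and a point of the box [LB, UB] scaled
   by the remaining weight; the constraints of (SU) are exactly the support
   inequalities of this Minkowski sum, and the splitting is obtained by clamping
   each coordinate to the scaled box.  An extreme point is then one of the
   points of which it is a convex combination. *)
Require Import Defs.
From HB Require Import structures.
From mathcomp Require Import all_boot all_order all_algebra.
From mathcomp Require Import mathcomp_extra boolp classical_sets reals.
From mathcomp Require Import interval_inference convex.
From mathcomp Require Import ring lra.

Set Implicit Arguments.
Unset Strict Implicit.
Unset Printing Implicit Defensive.
Import Order.TTheory GRing.Theory Num.Theory.
Local Open Scope ring_scope.

(** * Finite convex combinations and extreme points of a convex set *)

Section ConvexCombination.
Variables (R : realType) (V : lmodType R) (A : set V).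
Hypothesis cvxA : convex_set A.

Lemma convex_set_conv (a b : V) (t : R) :
  A a -> A b -> 0 <= t <= 1 -> A (t *: a + (1 - t) *: b).
Proof.
move=> Aa Ab /andP[t0 t1]; have := cvxA (Itv01 t0 t1).
by move=> /(_ a b); rewrite !inE; apply.
Qed.

(** The total weight is factored out rather than normalised to 1, so that the induction also covers
    total weight 0, where any point of [A] serves. *)
Lemma convex_set_sum (I : eqType) (r : seq I) (t : I -> R) (u : I -> V) :
  (A !=set0)%classic -> {in r, forall i, 0 <= t i} ->
  {in r, forall i, A (u i)} ->
  exists2 a, A a & \sum_(i <- r) t i *: u i = (\sum_(i <- r) t i) *: a.
Proof.
move=> A0; elim: r => [|i r IHr] tge0 Au.
  by have [a Aa] := A0; exists a; rewrite // !big_nil scale0r.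
have [j jr|j jr|a Aa eqa] := IHr.
- by apply: tge0; rewrite inE jr orbT.
- by apply: Au; rewrite inE jr orbT.
have ti : 0 <= t i by apply: tge0; rewrite mem_head.
have Si : 0 <= \sum_(j <- r) t j.
  by rewrite big_seq; apply: sumr_ge0 => j jr; apply: tge0; rewrite inE jr orbT.
rewrite !big_cons eqa; set S := \sum_(j <- r) t j in Si *.
have [S0|S0] := eqVneq (t i + S) 0.
  have t0 : t i = 0 by lra.
  have -> : S = 0 by lra.
  by exists a; rewrite // t0 addr0 !scale0r addr0.
have Sgt0 : 0 < t i + S by rewrite lt0r S0 addr_ge0.
exists ((t i / (t i + S)) *: u i + (1 - t i / (t i + S)) *: a).
  apply: convex_set_conv => //; first by apply: Au; rewrite mem_head.
  by apply/andP; rewrite (divr_ge0 ti (ltW Sgt0)) ler_pdivrMr // mul1r lerDl.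
by rewrite scalerDr !scalerA; congr (_ *: _ + _ *: _); field.
Qed.

(** Pick an index of positive weight and merge all the others into one point of [A]. This writes [v]
    as a combination of two points, to which extremality applies unless the chosen weight is already
    1. *)
Lemma extreme_point_conv (I : eqType) (r : seq I) (t : I -> R) (u : I -> V) v :
  {in r, forall i, 0 <= t i} -> \sum_(i <- r) t i = 1 ->
  {in r, forall i, A (u i)} -> v = \sum_(i <- r) t i *: u i ->
  extreme_point A v -> exists2 i, i \in r & v = u i.
Proof.
move=> tge0 t1 Au vE [Av extv].
have [i ir ti0] : exists2 i, i \in r & 0 < t i.
  apply/hasP; apply: contraT => /hasPn tle0.
  suff : \sum_(i <- r) t i <= 0 by rewrite t1 leNgt ltr01.
  by rewrite big_seq; apply: sumr_le0 => i /tle0; rewrite -leNgt.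
exists i => //.
have [r' r'r permr] : exists2 r', {subset r' <= r} & perm_eq r (i :: r').
  by exists (rem i r); [exact: mem_rem | exact: perm_to_rem].
have [||a Aa eqa] := @convex_set_sum I r' t u (ex_intro _ v Av).
- by move=> j /r'r; apply: tge0.
- by move=> j /r'r; apply: Au.
move: t1 vE; rewrite !(perm_big _ permr) !big_cons eqa /= => t1 vE.
have r'E : \sum_(j <- r') t j = 1 - t i by lra.
rewrite {}r'E in vE.
have r'ge0 : 0 <= \sum_(j <- r') t j.
  by rewrite big_seq; apply: sumr_ge0 => j /r'r; apply: tge0.
have [ti1|ti1] := eqVneq (t i) 1.
  by rewrite vE ti1 subrr scale0r scale1r addr0.
suff : u i = v /\ a = v by case.
apply: extv vE => //; first exact: Au.
by rewrite ti0 lt_neqAle ti1/=; lra.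
Qed.

End ConvexCombination.

Lemma axis_eqE : (X == Y = false) * (Y == X = false).
Proof. by []. Qed.

(** * Named coordinates on the space of (SU), and convexity of its relaxation *)

Section Coordinates.
Variables (R : realType) (T : eqType) (i j : T).
Implicit Types (v : SU_space R) (k l : T) (s : axis) (f : T * T * axis).

Definition objects : seq (T * axis) := [:: (i, X); (j, X); (i, Y); (j, Y)].

Definition point (c : T -> axis -> R) (d : T * T * axis -> R) : SU_space R :=
  (\row_m c (nth (i, X) objects m).1 (nth (i, X) objects m).2,
   \row_m d (nth (i, j, X) (F i j) m)).

Lemma cvar_point c d k s :
  (k, s) \in objects -> cvar i j (point c d) k s = c k s.
Proof.
move=> ks; rewrite /cvar mxE inordK ?nth_index //.
by have := ks; rewrite -index_mem.
Qed.

Lemma dvar_point c d k l s :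
  (k, l, s) \in F i j -> dvar i j (point c d) k l s = d (k, l, s).
Proof.
move=> ks; rewrite /dvar mxE inordK ?nth_index //.
by have := ks; rewrite -index_mem.
Qed.

Lemma cvarD a b k s :
  cvar i j (a + b : SU_space R) k s = cvar i j a k s + cvar i j b k s.
Proof. by rewrite /cvar !mxE. Qed.

Lemma dvarD a b k l s :
  dvar i j (a + b : SU_space R) k l s = dvar i j a k l s + dvar i j b k l s.
Proof. by rewrite /dvar !mxE. Qed.

Lemma cvarZ t a k s : cvar i j (t *: a : SU_space R) k s = t * cvar i j a k s.
Proof. by rewrite /cvar !mxE. Qed.

Lemma dvarZ t a k l s :
  dvar i j (t *: a : SU_space R) k l s = t * dvar i j a k l s.
Proof. by rewrite /dvar !mxE. Qed.

Hypothesis hij : i != j.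

Lemma uniq_objects : uniq objects.
Proof.
by rewrite /= !inE !xpair_eqE ![j == i]eq_sym (negbTE hij) !axis_eqE !andbF.
Qed.

Lemma uniq_F : uniq (F i j).
Proof.
by rewrite /= !inE !xpair_eqE ![j == i]eq_sym (negbTE hij) !axis_eqE !andbF.
Qed.

Lemma pointK v :
  point (cvar i j v) (fun f => dvar i j v f.1.1 f.1.2 f.2) = v.
Proof.
case: v => c d; congr pair; apply/rowP => m; rewrite mxE.
  rewrite /cvar -surjective_pairing index_uniq ?uniq_objects //.
  by rewrite inord_val.
rewrite /dvar -!surjective_pairing index_uniq ?uniq_F //.
by rewrite inord_val.
Qed.

Lemma SU_space_ext v v' :
  {in objects, forall p, cvar i j v p.1 p.2 = cvar i j v' p.1 p.2} ->
  (forall k l s, (k, l, s) \in F i j -> dvar i j v k l s = dvar i j v' k l s) ->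
  v = v'.
Proof.
move=> ec ed; rewrite -[v]pointK -[v']pointK /point.
congr pair; apply/rowP => m; rewrite !mxE.
  by rewrite ec // mem_nth.
apply: ed; rewrite -!surjective_pairing; exact: mem_nth.
Qed.

Lemma bin_var_dvar v (m : 'I_4) :
  exists k l s, (k, l, s) \in F i j /\ v.2 ord0 m = dvar i j v k l s.
Proof.
case E: (nth (i, j, X) (F i j) m) => [[k l] s].
have mF : nth (i, j, X) (F i j) m \in F i j by exact: mem_nth.
exists k, l, s; split; first by rewrite -E.
by rewrite /dvar -E index_uniq ?uniq_F // inord_val.
Qed.

Lemma dvar_bin_var v k l s :
  exists m : 'I_4, dvar i j v k l s = v.2 ord0 m.
Proof. by exists (inord (index (k, l, s) (F i j))). Qed.

Lemma relaxationP (LB UB : T -> axis -> R) P v :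
  relaxation (SU LB UB P i j) v <->
  SU_constraints LB UB P i j v /\
  (forall k l s, (k, l, s) \in F i j -> 0 <= dvar i j v k l s <= 1).
Proof.
split=> -[cv bv]; split=> //.
  by move=> k l s _; have [m ->] := dvar_bin_var v k l s; exact: bv.
by move=> m /=; have [k [l [s [/bv hb ->]]]] := bin_var_dvar v m.
Qed.

(** Every constraint is affine in [(c, d)], so mixing two instances of it with weights [x] and
    [1 - x] gives the instance for the mixed point. *)
Lemma convex_relaxation_SU (LB UB : T -> axis -> R) P :
  convex_set (relaxation (SU LB UB P i j)).
Proof.
move=> a b t; rewrite !inE => /relaxationP[[ca sa] ba] /relaxationP[[cb sb] bb].
apply/relaxationP.
have -> : conv t (a : convex_lmodType _) b = t%:num *: a + (1 - t%:num) *: b.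
  by [].
have t0 : 0 <= t%:num by [].
have t1 : 0 <= 1 - t%:num by rewrite subr_ge0.
move: (t%:num) t0 t1 => x x0 x1.
split; [split|]; last first.
- move=> k l s kls; rewrite dvarD !dvarZ.
  have /andP[a0 a1] := ba _ _ _ kls; have /andP[b0 b1] := bb _ _ _ kls.
  apply/andP; split; nra.
- rewrite /= in sa sb *; rewrite !dvarD !dvarZ.
  by have := congr1 ( *%R x) sa; have := congr1 ( *%R (1 - x)) sb; lra.
move=> k l s kls; rewrite !cvarD !cvarZ dvarD !dvarZ.
have [a1 a2 a3] := ca _ _ _ kls; have [b1 b2 b3] := cb _ _ _ kls.
have mix (p q p' q' : R) : p <= q -> p' <= q' ->
  x * p + (1 - x) * p' <= x * q + (1 - x) * q'.
  by move=> pq pq'; apply: lerD; exact: ler_wpM2l.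
by split; [have := mix _ _ _ _ a1 b1 | have := mix _ _ _ _ a2 b2 |
  have := mix _ _ _ _ a3 b3]; lra.
Qed.

End Coordinates.

(** * Splitting a point of the relaxation into four points with unit [d] *)

Section Vertices.
Variables (R : realType) (T : eqType) (i j : T).
Variables (LB UB : T -> axis -> R) (P : T -> T -> axis -> R).
Hypothesis hij : i != j.
Hypothesis LB_P : forall k l s, (k, l, s) \in F i j ->
  LB l s <= LB k s + P k l s.
Hypothesis UB_P : forall k l s, (k, l, s) \in F i j ->
  UB l s - P k l s <= UB k s.
Hypothesis P_lt : forall k l s, (k, l, s) \in F i j ->
  LB k s + P k l s < UB l s.
Variable v : SU_space R.
Hypothesis relv : relaxation (SU LB UB P i j) v.

Let c := cvar i j v.
Let d := dvar i j v.
Let D k s := UB k s - LB k s.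
Let other k := if k == i then j else i.

(* The weight of the two disjuncts that do not order i and j along s. *)
Let free s := 1 - d i j s - d j i s.

(* The offset of c from the corner at which object k lies at UB when it is
   preceded along s and at LB otherwise. *)
Let offset k s := c k s - LB k s - d (other k) k s * D k s.

(** Clamping [offset k s] to the interval from 0 to [free s * D k s] leaves two remainders. The
    overshoot [excess] moves [k] up from LB in the disjunct where it precedes; the undershoot
    [deficit] moves it down from UB in the disjunct where it is preceded. *)
Let excess k s := Num.max 0 (offset k s - free s * D k s).
Let deficit k s := Num.max 0 (- offset k s).

(* Every division is harmless at weight 0: the numerators then vanish and
   x / 0 = 0. *)
Definition vertex f : SU_space R :=
  point i j
    (fun k s =>
       if s != f.2 then
         LB k s + (offset k s - excess k s + deficit k s) / free s
       else if k == f.1.1 then LB k s + excess k s / d f.1.1 f.1.2 s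
       else UB k s - deficit k s / d f.1.1 f.1.2 s)
    (fun g => (g == f)%:R).

Lemma F_cases k l s : (k, l, s) \in F i j ->
  (k = i /\ l = j) \/ (k = j /\ l = i).
Proof. by rewrite !inE => /or4P[] /eqP[-> -> _]; [left|right|left|right]. Qed.

Lemma mem_F_ij s : (i, j, s) \in F i j.
Proof. by case: s; rewrite !inE eqxx ?orbT. Qed.

Lemma mem_F_ji s : (j, i, s) \in F i j.
Proof. by case: s; rewrite !inE eqxx ?orbT. Qed.

Lemma mem_objects k s : k \in [:: i; j] -> (k, s) \in objects i j.
Proof. by rewrite !inE => /orP[] /eqP->; case: s; rewrite eqxx ?orbT. Qed.

Lemma other_i : other i = j. Proof. by rewrite /other eqxx. Qed.

Lemma other_j : other j = i.
Proof. by rewrite /other eq_sym (negbTE hij). Qed.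

Lemma d01 k l s : (k, l, s) \in F i j -> 0 <= d k l s <= 1.
Proof. by have /(relaxationP hij)[_] := relv; apply. Qed.

Lemma free_sum s s' : s != s' -> free s = d i j s' + d j i s'.
Proof.
have /(relaxationP hij)[[_ /= dsum] _] := relv.
by case: s s' => -[] // _; rewrite /free /d -dsum; ring.
Qed.

Lemma free_ge0 s : 0 <= free s.
Proof.
have [s' ss'] : exists s', s != s' by case: s; [exists Y|exists X].
rewrite (free_sum ss').
have /andP[? _] := d01 (mem_F_ij s'); have /andP[? _] := d01 (mem_F_ji s').
exact: addr_ge0.
Qed.

(** The lower bound that [k] gets when preceded by the other object lies between LB and UB of
    [k]. *)
Lemma D_ge0 k s : k \in [:: i; j] -> 0 <= D k s.
Proof.
rewrite !inE /D => /orP[] /eqP->.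
  by have := LB_P (mem_F_ji s); have := P_lt (mem_F_ji s); lra.
by have := LB_P (mem_F_ij s); have := P_lt (mem_F_ij s); lra.
Qed.

(* The four cases of the two maxima are the three constraints of (SU) for
   (k, l, s) and P k l s < UB l s - LB k s. *)
Lemma excess_deficit k l s : (k, l, s) \in F i j ->
  excess k s + deficit l s <= d k l s * (UB l s - P k l s - LB k s).
Proof.
move=> kls; have /(relaxationP hij)[[cv _] _] := relv.
have /andP[dkl _] := d01 kls.
have [A1 A2 A3] := cv _ _ _ kls.
have A4 : 0 <= d k l s * (UB l s - P k l s - LB k s).
  by apply: mulr_ge0 => //; have := P_lt kls; lra.
rewrite /excess /deficit /offset /free /D.
have [[? ?]|[? ?]] := F_cases kls; subst k l; rewrite ?other_i ?other_j;
  rewrite -/c -/d in A1 A2 A3 *; rewrite maxEle [X in _ + X]maxEle;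
  case: ifP => _; case: ifP => _; lra.
Qed.

Lemma excess_ge0 k s : 0 <= excess k s.
Proof. by rewrite /excess le_max lexx. Qed.

Lemma deficit_ge0 k s : 0 <= deficit k s.
Proof. by rewrite /deficit le_max lexx. Qed.

(** With [k] placed at LB plus the first quotient and [l] at UB minus the second, this is the
    slanted side of the triangle in which [k] precedes [l]. At weight 0 both quotients are 0 and
    [P_lt] suffices. *)
Lemma scaled_excess_deficit k l s : (k, l, s) \in F i j ->
  excess k s / d k l s + deficit l s / d k l s <=
  UB l s - P k l s - LB k s.
Proof.
move=> kls; have /andP[dkl _] := d01 kls.
have [->|d0] := eqVneq (d k l s) 0.
  by rewrite invr0 !mulr0; have := P_lt kls; lra.
rewrite -mulrDl ler_pdivrMr ?lt0r ?d0 // mulrC.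
exact: excess_deficit.
Qed.

Lemma scaled_excess_deficit_ge0 k l s : (k, l, s) \in F i j ->
  0 <= excess k s / d k l s /\ 0 <= deficit l s / d k l s.
Proof.
move=> kls; have /andP[dkl _] := d01 kls.
by split; rewrite divr_ge0 // ?excess_ge0 ?deficit_ge0.
Qed.

Lemma clamp k s : k \in [:: i; j] ->
  0 <= offset k s - excess k s + deficit k s <= free s * D k s.
Proof.
move=> kij; have := mulr_ge0 (free_ge0 s) (D_ge0 s kij).
rewrite /excess /deficit; set x := offset k s; set y := free s * _ => y0.
by rewrite !maxEle; case: (lerP 0 (x - y)); case: (lerP 0 (- x)); lra.
Qed.

Lemma clamp_div k s : k \in [:: i; j] ->
  0 <= (offset k s - excess k s + deficit k s) / free s <= D k s.
Proof.
move=> kij; have /andP[x0 xD] := clamp s kij.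
rewrite divr_ge0 ?free_ge0 //=.
have [->|f0] := eqVneq (free s) 0; first by rewrite invr0 mulr0 D_ge0.
by rewrite ler_pdivrMr ?lt0r ?f0 ?free_ge0 // mulrC.
Qed.

(** * Feasibility of the four points *)

Lemma vertex_bounds f k s : f \in F i j -> k \in [:: i; j] ->
  LB k s <= cvar i j (vertex f) k s <= UB k s.
Proof.
case: f => [[k' l'] s'] fF kij; rewrite cvar_point ?mem_objects //=.
move: fF; case: eqVneq => [<-{s'}|_] /= fF; last first.
  by have := clamp_div s kij; rewrite /D; lra.
have := scaled_excess_deficit fF; have := scaled_excess_deficit_ge0 fF.
(* The triangle lies in the box: [UB_P] keeps the predecessor below its UB, and [LB_P] keeps the
   successor above its LB. *)
have := LB_P fF; have := UB_P fF.
have [->|kk'] := eqVneq k k'; first by lra.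
suff -> : k = l' by lra.
have [[? ?]|[? ?]] := F_cases fF; subst k' l';
  by move: kij; rewrite !inE (negbTE kk') ?orbF /= => /eqP.
Qed.

Lemma vertex_order k l s : (k, l, s) \in F i j ->
  cvar i j (vertex (k, l, s)) k s + P k l s <= cvar i j (vertex (k, l, s)) l s.
Proof.
move=> kls; have kij : (k \in [:: i; j]) && (l \in [:: i; j]) && (l != k).
  by have [[-> ->]|[-> ->]] := F_cases kls;
     rewrite !inE !eqxx ?orbT //= eq_sym ?hij // eq_sym.
case/andP: kij => /andP[kij lij] lk.
rewrite !cvar_point ?mem_objects //= !eqxx /= (negbTE lk).
by have := scaled_excess_deficit kls; lra.
Qed.

Lemma vertex_relaxation f : f \in F i j ->
  relaxation (SU LB UB P i j) (vertex f).
Proof.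
move=> fF; apply/(relaxationP hij); split; [split|]; last first.
- move=> k l s kls; rewrite dvar_point //.
  by case: eqP => _; rewrite ?lexx ler01.
- rewrite /= !dvar_point ?mem_F_ij ?mem_F_ji //.
  move: fF; rewrite !inE => /or4P[] /eqP->; rewrite !xpair_eqE !eqxx;
    rewrite ![j == i]eq_sym ?(negbTE hij) ?axis_eqE /=; lra.
move=> k l s kls.
have /andP[kij lij] : (k \in [:: i; j]) && (l \in [:: i; j]).
  by have [[-> ->]|[-> ->]] := F_cases kls; rewrite !inE !eqxx ?orbT.
have := vertex_bounds s fF kij; have := vertex_bounds s fF lij.
(* With [d = 0] the three constraints follow from the box; with [d = 1] they follow from the box and
   the separation of [k] and [l] by [P k l s]. *)
rewrite dvar_point //; case: eqP => [<-|_] /=; last by split; lra.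
have := vertex_order kls; have := LB_P kls; have := UB_P kls.
by split; lra.
Qed.

(** * Recombination of the four points into [v] *)

Lemma free_split k s : k \in [:: i; j] ->
  free s * ((offset k s - excess k s + deficit k s) / free s) =
  offset k s - excess k s + deficit k s.
Proof.
move=> kij; have [f0|f0] := eqVneq (free s) 0; last by field.
by have := clamp s kij; rewrite f0 !mul0r; lra.
Qed.

(** At weight 0, [excess_deficit] bounds the sum of two nonnegative numbers by 0, so both vanish. *)
Lemma excess_split k l s : (k, l, s) \in F i j ->
  d k l s * (excess k s / d k l s) = excess k s /\
  d k l s * (deficit l s / d k l s) = deficit l s.
Proof.
move=> kls; have [d0|d0] := eqVneq (d k l s) 0; last by split; field.
have := excess_deficit kls; have := excess_ge0 k s; have := deficit_ge0 l s.
by rewrite d0 !mul0r; lra.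
Qed.

(** On axis [s], the two points ordered along the other axis share the clamped position and have
    total weight [free s]. The two ordered along [s] contribute the corner, plus [excess], minus
    [deficit]; together these restore [offset]. *)
Lemma vertex_decomposition :
  v = \sum_(f <- F i j) d f.1.1 f.1.2 f.2 *: vertex f.
Proof.
rewrite !big_cons big_nil addr0 /=; apply: (SU_space_ext hij).
  move=> [k s] ksO; rewrite !cvarD !cvarZ !cvar_point //=.
  have kij : k \in [:: i; j].
    by move: ksO; rewrite !inE !xpair_eqE => /or4P[] /andP[-> _]; rewrite ?orbT.
  have [e1 e2] := excess_split (mem_F_ij s).
  have [e3 e4] := excess_split (mem_F_ji s).
  have [s' ss'] : exists s', s != s'.
    by case: s {ksO e1 e2 e3 e4}; [exists Y|exists X].
  have freeE := free_sum ss'.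
  (* The weights sum to 1; having this multiplied by [LB k s] makes the final identity linear in the
     products of weights and coordinates. *)
  have LBs : LB k s * (d i j s + d j i s + free s) = LB k s.
    by rewrite /free; ring.
  have cE : cvar i j v k s = LB k s + d (other k) k s * D k s + offset k s.
    by rewrite /offset /c; ring.
  have := free_split s kij; set q := _ / free s; rewrite freeE in LBs *.
  rewrite cE /D => fs; move: ss' q fs LBs {ksO cE freeE}.
  move: kij; rewrite !inE => /orP[] /eqP->; rewrite ?other_i ?other_j;
    case: s s' e1 e2 e3 e4 => -[] // e1 e2 e3 e4 _ q fs LBs;
    rewrite ?eqxx ?axis_eqE ?[j == i]eq_sym ?(negbTE hij) /=; lra.
move=> k l s kls; rewrite !dvarD !dvarZ !dvar_point // -/d.
move: kls; rewrite !inE => /or4P[] /eqP[-> -> ->];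
  rewrite !xpair_eqE !eqxx ![j == i]eq_sym (negbTE hij) !axis_eqE /=; lra.
Qed.

Lemma extreme_point_relaxation_vertex :
  extreme_point (relaxation (SU LB UB P i j)) v ->
  exists2 f, f \in F i j & v = vertex f.
Proof.
apply: (extreme_point_conv (convex_relaxation_SU hij (P := P)) _ _
  vertex_relaxation vertex_decomposition).
  by move=> [[k l] s] /d01 /andP[].
have /(relaxationP hij)[[_ /= <-] _] := relv.
by rewrite !big_cons big_nil addr0 !addrA.
Qed.

End Vertices.

(** * Integrality of the extreme points of (SU) *)

Lemma SU_extreme_point_binary (R : realType) (T : eqType) (i j : T)
    (LB UB : T -> axis -> R) (P : T -> T -> axis -> R) v (m : 'I_4) :
  i != j ->
  (forall k l s, (k, l, s) \in F i j ->
    [/\ LB l s <= LB k s + P k l s, UB l s - P k l s <= UB k s &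
         LB k s + P k l s < UB l s]) ->
  extreme_point (relaxation (SU LB UB P i j)) v ->
  v.2 ord0 m = 0 \/ v.2 ord0 m = 1.
Proof.
move=> hij hF extv.
have h1 k l s : (k, l, s) \in F i j -> LB l s <= LB k s + P k l s by case/hF.
have h2 k l s : (k, l, s) \in F i j -> UB l s - P k l s <= UB k s by case/hF.
have h3 k l s : (k, l, s) \in F i j -> LB k s + P k l s < UB l s by case/hF.
have [f _ vE] := extreme_point_relaxation_vertex hij h1 h2 h3 extv.1 extv.
(* The second component of [vertex f] is the indicator of [f]. *)
by rewrite vE mxE; case: eqP => _; [right|left].
Qed.

Theorem theorem1 (R : realType) (T : eqType) (i j : T)
    (W : axis -> R) (w sm sp : T -> axis -> R) (P : T -> T -> axis -> R)
    (hij : i != j)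
    (hw : forall k s, k \in [:: i; j] -> 0 < w k s)
    (hsm : forall k s, k \in [:: i; j] -> 0 <= sm k s)
    (hsp : forall k s, k \in [:: i; j] -> 0 <= sp k s)
    (hP : forall k l s, (k, l, s) \in F i j ->
      w k s / 2 + w l s / 2 + Num.max (sp k s) (sm l s) <= P k l s)
    (hlt : forall k l s, (k, l, s) \in F i j ->
      P k l s < UB W w sp l s - LB w sm k s) :
  ideal (SU (LB w sm) (UB W w sp) P i j) /\
  forall c d : 'rV[R]_4,
    extreme_point (relaxation (SU (LB w sm) (UB W w sp) P i j)) (c, d) ->
    forall m : 'I_4, d ord0 m = 0 \/ d ord0 m = 1.
Proof.
have binary v (m : 'I_4) :
    extreme_point (relaxation (SU (LB w sm) (UB W w sp) P i j)) v ->
    v.2 ord0 m = 0 \/ v.2 ord0 m = 1.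
  apply: SU_extreme_point_binary => // k l s kls.
  have := hP _ _ _ kls; have := hlt _ _ _ kls.
  have /andP[kij lij] : (k \in [:: i; j]) && (l \in [:: i; j]).
    by have [[-> ->]|[-> ->]] := F_cases kls; rewrite !inE !eqxx ?orbT.
  have := hw k s kij; have := hw l s lij.
  have := hsm k s kij; have := hsp l s lij.
  (* The margin dominates both clearances: [sp k s] gives the inequality between the UBs, and
     [sm l s] the one between the LBs. The strict inequality is [hlt]. *)
  have : sp k s <= Num.max (sp k s) (sm l s) by rewrite le_max lexx.
  have : sm l s <= Num.max (sp k s) (sm l s) by rewrite le_max lexx orbT.
  by move: (Num.max _ _) => M; rewrite /LB /UB; split; lra.
split=> [v ext_v m /=|c d ext_cd m]; last exact: binary (c, d) m ext_cd.
by have [->|->] := binary v m ext_v.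
Qed.
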